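(* Let $f : Y\to X$ and $g : Z\to Y$ be maps of simplicial sets, each equipped with a choice of solution to every lifting problem against a horn inclusion. Then, without appeal to the axiom of choice, the object $\Pi_f(g)\in\mathsf{sSet}/X$ may be equipped with a choice of solution to every lifting problem of a horn inclusion against its structure map to $X$.
   Context: $\mathsf{sSet}$ is the category of simplicial sets. The horn inclusions are $\Lambda^n_k\hookrightarrow\triangle^n$ for $n\ge1$, $0\le k\le n$. For a map $p:E\to S$, a choice of solution to every horn-filling problem is a function assigning to every commutative square from a horn inclusion $\Lambda^n_k\hookrightarrow\triangle^n$ to $p$ a diagonal filler $\triangle^n\to E$. For $f:Y\to X$, $f^*:\mathsf{sSet}/X\to\mathsf{sSet}/Y$ is the pullback functor and $\Pi_f:\mathsf{sSet}/Y\to\mathsf{sSet}/X$ is its right adjoint (pushforward). *)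

(* Defs.v *)
From HB Require Import structures.
From mathcomp Require Import all_boot.
From Stdlib Require Import FunctionalExtensionality ProofIrrelevance.

Set Implicit Arguments.
Unset Strict Implicit.
Unset Printing Implicit Defensive.

Definition monotone m n (t : {ffun 'I_m.+1 -> 'I_n.+1}) : bool :=
  [forall i : 'I_m.+1, forall j : 'I_m.+1, (i <= j) ==> (t i <= t j)].

Record delta (m n : nat) := Delta {
  dfun :> {ffun 'I_m.+1 -> 'I_n.+1};
  dfun_mono : monotone dfun }.

HB.instance Definition _ m n := [isSub for @dfun m n].
HB.instance Definition _ m n := [Finite of delta m n by <:].

Lemma deltaP m n (s t : delta m n) : (forall i, s i = t i) -> s = t.
Proof. by move=> st; apply/val_inj/ffunP. Qed.

Lemma delta_leq m n (t : delta m n) (i j : 'I_m.+1) : i <= j -> t i <= t j.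
Proof. by move=> ij; have /forallP/(_ i)/forallP/(_ j)/implyP := dfun_mono t; apply. Qed.

Lemma did_subproof n : monotone [ffun i : 'I_n.+1 => i].
Proof. by apply/forallP => i; apply/forallP => j; rewrite !ffunE; apply/implyP. Qed.

Definition did n : delta n n := Delta (did_subproof n).

Lemma dcomp_subproof m n p (s : delta n p) (t : delta m n) :
  monotone [ffun i => s (t i)].
Proof.
apply/forallP => i; apply/forallP => j; rewrite !ffunE; apply/implyP => ij.
by do 2!apply: delta_leq.
Qed.

Definition dcomp m n p (s : delta n p) (t : delta m n) : delta m p :=
  Delta (dcomp_subproof s t).

Lemma dcompE m n p (s : delta n p) (t : delta m n) i : dcomp s t i = s (t i).
Proof. by rewrite ffunE. Qed.

Lemma didE n i : did n i = i.
Proof. by rewrite ffunE. Qed.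

Lemma dcomp1d m n (t : delta m n) : dcomp (did n) t = t.
Proof. by apply: deltaP => i; rewrite dcompE didE. Qed.

Lemma dcompd1 m n (t : delta m n) : dcomp t (did m) = t.
Proof. by apply: deltaP => i; rewrite dcompE didE. Qed.

Lemma dcompA m n p q (r : delta p q) (s : delta n p) (t : delta m n) :
  dcomp r (dcomp s t) = dcomp (dcomp r s) t.
Proof. by apply: deltaP => i; rewrite !dcompE. Qed.

Record sSet := SSet {
  cells :> nat -> Type;
  act : forall m n, delta m n -> cells n -> cells m;
  act_id : forall n (x : cells n), act (did n) x = x;
  act_comp : forall m n p (s : delta n p) (t : delta m n) (x : cells p),
    act (dcomp s t) x = act t (act s x) }.

Arguments act {_ m n}.

Record smap (A B : sSet) := SMap {
  app :> forall n, A n -> B n;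
  app_act : forall m n (t : delta m n) (a : A n), app (act t a) = act t (app a) }.

Arguments app {A B} _ {n}.

Lemma smapP (A B : sSet) (f g : smap A B) :
  (forall n (a : A n), f n a = g n a) -> f = g.
Proof.
case: f g => [f fn] [g gn] /= fg.
have e : f = g.
  apply: functional_extensionality_dep => n.
  exact: functional_extensionality_dep (fg n).
by subst g; congr SMap; apply: proof_irrelevance.
Qed.

Definition sid (A : sSet) : smap A A :=
  @SMap A A (fun _ a => a) (fun _ _ _ _ => erefl).

Lemma scomp_subproof (A B C : sSet) (g : smap B C) (f : smap A B)
  m n (t : delta m n) (a : A n) :
  g m (f m (act t a)) = act t (g n (f n a)).
Proof. by rewrite !app_act. Qed.

Definition scomp (A B C : sSet) (g : smap B C) (f : smap A B) : smap A C :=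
  SMap (scomp_subproof g f).

Notation "g \os f" := (scomp g f) (at level 40, left associativity).

Definition simplex (n : nat) : sSet :=
  @SSet (fun m => delta m n) (fun _ _ t x => dcomp x t)
    (fun _ x => dcompd1 x) (fun _ _ _ s t x => dcompA x s t).

(** The horn is the union of the faces of the [n]-simplex opposite to the
    vertices [j <> k]: a simplex lies in the face opposite to [j] exactly when
    it misses the vertex [j]. *)
Definition in_horn n (k : 'I_n.+1) m (x : delta m n) : bool :=
  [exists j, (j != k) && [forall i, x i != j]].

Lemma in_horn_act n (k : 'I_n.+1) p m (t : delta p m) (x : delta m n) :
  in_horn k x -> in_horn k (dcomp x t).
Proof.
case/existsP => j /andP[jk /forallP xj]; apply/existsP; exists j.
by rewrite jk; apply/forallP => i; rewrite dcompE.
Qed.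

Definition horn_cell n (k : 'I_n.+1) (m : nat) : Type :=
  {x : delta m n | in_horn k x}.

Definition horn_act n (k : 'I_n.+1) p m (t : delta p m) (x : horn_cell k m) :
  horn_cell k p := exist _ (dcomp (val x) t) (in_horn_act t (valP x)).

Lemma horn_act_id n (k : 'I_n.+1) m (x : horn_cell k m) : horn_act (did m) x = x.
Proof. by apply: val_inj; apply: dcompd1. Qed.

Lemma horn_act_comp n (k : 'I_n.+1) m p q (s : delta p q) (t : delta m p)
  (x : horn_cell k q) : horn_act (dcomp s t) x = horn_act t (horn_act s x).
Proof. by apply: val_inj; apply: dcompA. Qed.

Definition horn n (k : 'I_n.+1) : sSet :=
  SSet (@horn_act_id n k) (@horn_act_comp n k).

Definition horn_incl n (k : 'I_n.+1) : smap (horn k) (simplex n) :=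
  @SMap (horn k) (simplex n) (fun _ x => val x) (fun _ _ _ _ => erefl).

(** Fillers are data in [Type], not existence statements in [Prop]: a term of
    [horn_fillers p] is a function choosing a filler of every square. *)

Definition filler (A B E S : sSet) (i : smap A B) (p : smap E S)
    (u : smap A E) (v : smap B S) : Type :=
  {w : smap B E | w \os i = u /\ p \os w = v}.

Definition horn_fillers (E S : sSet) (p : smap E S) : Type :=
  forall (n : nat) (k : 'I_n.+1), 0 < n ->
  forall (u : smap (horn k) E) (v : smap (simplex n) S),
    p \os u = v \os horn_incl k -> filler (horn_incl k) p u v.

Record over (X : sSet) := Over { dom :> sSet; str : smap dom X }.

Definition over_hom (X : sSet) (A B : over X) : Type :=
  {h : smap A B | str B \os h = str A}.

Definition over_map (X : sSet) (A B : over X) (h : over_hom A B) : smap A B :=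
  proj1_sig h.

Lemma over_mapE (X : sSet) (A B : over X) (h : over_hom A B) n (a : A n) :
  str B n (over_map h n a) = str A n a.
Proof. by case: h => h /= <-. Qed.

Lemma over_homP (X : sSet) (A B : over X) (h h' : over_hom A B) :
  (forall n (a : A n), over_map h n a = over_map h' n a) -> h = h'.
Proof.
case: h h' => [h e] [h' e'] /= hh; have eh := smapP hh; subst h'.
by congr exist; apply: proof_irrelevance.
Qed.

Lemma over_id_subproof (X : sSet) (A : over X) : str A \os sid A = str A.
Proof. exact: smapP. Qed.

Definition over_id (X : sSet) (A : over X) : over_hom A A :=
  exist _ (sid A) (over_id_subproof A).

Lemma over_comp_subproof (X : sSet) (A B C : over X)
  (h : over_hom B C) (k : over_hom A B) :
  str C \os (over_map h \os over_map k) = str A.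
Proof. by apply: smapP => n a /=; rewrite !over_mapE. Qed.

Definition over_comp (X : sSet) (A B C : over X)
    (h : over_hom B C) (k : over_hom A B) : over_hom A C :=
  exist _ (over_map h \os over_map k) (over_comp_subproof h k).

Section Pullback.
Variables (X Y : sSet) (f : smap Y X).

Definition pull_cell (A : over X) (n : nat) : Type :=
  {ay : A n * Y n | str A n ay.1 = f n ay.2}.

Lemma pull_cellP (A : over X) n (c d : pull_cell A n) : sval c = sval d -> c = d.
Proof.
by case: c d => [c e] [d e'] /= cd; subst d; congr exist; apply: proof_irrelevance.
Qed.

Lemma pull_act_subproof (A : over X) m n (t : delta m n) (c : pull_cell A n) :
  str A m (act t (sval c).1) = f m (act t (sval c).2).
Proof. by rewrite !app_act (svalP c). Qed.

Definition pull_act (A : over X) m n (t : delta m n) (c : pull_cell A n) :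
    pull_cell A m :=
  exist _ (act t (sval c).1, act t (sval c).2) (pull_act_subproof t c).

Lemma pull_act_id (A : over X) n (c : pull_cell A n) : pull_act (did n) c = c.
Proof. by apply: pull_cellP; case: c => [[a y] e] /=; rewrite !act_id. Qed.

Lemma pull_act_comp (A : over X) m n p (s : delta n p) (t : delta m n)
  (c : pull_cell A p) : pull_act (dcomp s t) c = pull_act t (pull_act s c).
Proof. by apply: pull_cellP => /=; rewrite !act_comp. Qed.

Definition pull_sset (A : over X) : sSet :=
  SSet (@pull_act_id A) (@pull_act_comp A).

Definition pull_str (A : over X) : smap (pull_sset A) Y :=
  @SMap (pull_sset A) Y (fun _ c => (sval c).2) (fun _ _ _ _ => erefl).

Definition pull (A : over X) : over Y := Over (pull_str A).

Section Functoriality.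
Variables (A B : over X) (h : over_hom A B).

Lemma pull_hom_subproof n (c : pull A n) :
  str B n (over_map h n (sval c).1) = f n (sval c).2.
Proof. by rewrite over_mapE (svalP c). Qed.

Definition pull_hom_cell n (c : pull A n) : pull B n :=
  exist _ (over_map h n (sval c).1, (sval c).2) (pull_hom_subproof c).

Lemma pull_hom_act m n (t : delta m n) (c : pull A n) :
  pull_hom_cell (act t c) = act t (pull_hom_cell c).
Proof. by apply: pull_cellP; rewrite /= app_act. Qed.

Lemma pull_hom_over :
  str (pull B) \os (SMap pull_hom_act : smap (pull A) (pull B)) = str (pull A).
Proof. exact: smapP. Qed.

Definition pull_hom : over_hom (pull A) (pull B) := exist _ _ pull_hom_over.

End Functoriality.
End Pullback.

Section Yoneda.
Variable X : sSet.

Lemma yoneda_subproof n (x : X n) p m (t : delta p m) (s : simplex n m) :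
  act (act t s) x = act t (act s x).
Proof. exact: act_comp. Qed.

(** The map [simplex n -> X] classifying [x : X n], as an object over [X]. *)
Definition yoneda n (x : X n) : over X :=
  @Over X (simplex n)
    (@SMap (simplex n) X (fun _ s => act s x) (yoneda_subproof x)).

Lemma yoneda_act_subproof m n (t : delta m n) p q (r : delta p q)
  (s : simplex m q) : dcomp t (dcomp s r) = dcomp (dcomp t s) r.
Proof. exact: dcompA. Qed.

Lemma yoneda_act_over m n (t : delta m n) (x : X n) :
  str (yoneda x) \os @SMap (simplex m) (simplex n) (fun _ s => dcomp t s)
                       (@yoneda_act_subproof m n t)
  = str (yoneda (act t x)).
Proof. by apply: smapP => p s /=; rewrite act_comp. Qed.

Definition yoneda_act m n (t : delta m n) (x : X n) :
  over_hom (yoneda (act t x)) (yoneda x) := exist _ _ (yoneda_act_over t x).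

End Yoneda.

Section Pushforward.
Variables (X Y : sSet) (f : smap Y X).

(** An [n]-simplex of the pushforward of [B] over [x : X n] is a morphism over
    [Y] from the pullback of [x : simplex n -> X] to [B], as forced by the
    adjunction and the Yoneda lemma. *)
Definition push_cell (B : over Y) (n : nat) : Type :=
  {x : X n & over_hom (pull f (yoneda x)) B}.

Lemma push_cellP (B : over Y) n (c d : push_cell B n) :
  projT1 c = projT1 d ->
  (forall m (s : delta m n) (y : Y m) e e',
     over_map (projT2 c) m (exist _ (s, y) e)
     = over_map (projT2 d) m (exist _ (s, y) e')) ->
  c = d.
Proof.
case: c d => [x h] [x' h'] /= xx; subst x' => hh; congr existT.
by apply: over_homP => m [[s y] e]; apply: hh.
Qed.

Definition push_act (B : over Y) m n (t : delta m n) (c : push_cell B n) :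
    push_cell B m :=
  existT _ (act t (projT1 c))
    (over_comp (projT2 c) (pull_hom f (yoneda_act t (projT1 c)))).

Lemma push_act_id (B : over Y) n (c : push_cell B n) : push_act (did n) c = c.
Proof.
apply: push_cellP => [|m s y e e'] /=; first exact: act_id.
by congr (app _ _); apply: pull_cellP; rewrite /= dcomp1d.
Qed.

Lemma push_act_comp (B : over Y) m n p (s : delta n p) (t : delta m n)
  (c : push_cell B p) : push_act (dcomp s t) c = push_act t (push_act s c).
Proof.
apply: push_cellP => [|q r y e e'] /=; first exact: act_comp.
by congr (app _ _); apply: pull_cellP; rewrite /= dcompA.
Qed.

Definition push_sset (B : over Y) : sSet :=
  SSet (@push_act_id B) (@push_act_comp B).

Definition push_str (B : over Y) : smap (push_sset B) X :=
  @SMap (push_sset B) X (fun _ c => projT1 c) (fun _ _ _ _ => erefl).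

Definition push (B : over Y) : over X := Over (push_str B).

Section Counit.
Variable B : over Y.

Lemma counit_cell_subproof n (c : pull f (push B) n) :
  act (did n) (projT1 (sval c).1) = f n (sval c).2.
Proof. by rewrite act_id; apply: (svalP c). Qed.

Definition counit_cell n (c : pull f (push B) n) : B n :=
  over_map (projT2 (sval c).1) n
    (exist _ (did n, (sval c).2) (counit_cell_subproof c)).

Lemma counit_act m n (t : delta m n) (c : pull f (push B) n) :
  counit_cell (act t c) = act t (counit_cell c).
Proof.
rewrite /counit_cell /= -app_act; congr (app _ _); apply: pull_cellP => /=.
by rewrite dcompd1 dcomp1d.
Qed.

Lemma counit_over :
  str B \os (SMap counit_act : smap (pull f (push B)) B) = str (pull f (push B)).
Proof. by apply: smapP => n c; rewrite /= over_mapE. Qed.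

Definition counit : over_hom (pull f (push B)) B := exist _ _ counit_over.

End Counit.

Section Transpose.
Variables (A : over X) (B : over Y) (h : over_hom (pull f A) B).

Lemma transpose_yo_subproof n (a : A n) p m (t : delta p m) (s : simplex n m) :
  act (act t s) a = act t (act s a).
Proof. exact: act_comp. Qed.

Lemma transpose_yo_over n (a : A n) :
  str A \os @SMap (simplex n) A (fun _ s => act s a) (transpose_yo_subproof a)
  = str (yoneda (str A n a)).
Proof. by apply: smapP => m s /=; rewrite app_act. Qed.

Definition transpose_yo n (a : A n) : over_hom (yoneda (str A n a)) A :=
  exist _ _ (transpose_yo_over a).

Definition transpose_cell n (a : A n) : push B n :=
  existT _ (str A n a) (over_comp h (pull_hom f (transpose_yo a))).

Lemma transpose_act m n (t : delta m n) (a : A n) :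
  transpose_cell (act t a) = act t (transpose_cell a).
Proof.
apply: push_cellP => [|p s y e e'] /=; first exact: app_act.
by congr (app _ _); apply: pull_cellP; rewrite /= act_comp.
Qed.

Lemma transpose_over :
  str (push B) \os (SMap transpose_act : smap A (push B)) = str A.
Proof. exact: smapP. Qed.

Definition transpose : over_hom A (push B) := exist _ _ transpose_over.

Lemma transposeK : over_comp (counit B) (pull_hom f transpose) = h.
Proof.
apply: over_homP => n [[a y] e] /=; rewrite /counit_cell /=.
by congr (app _ _); apply: pull_cellP; rewrite /= act_id.
Qed.

End Transpose.

Lemma push_sec_eq (B : over Y) n (c d : push B n) (cd : c = d)
  m (s : delta m n) (y : Y m) e e' :
  over_map (projT2 c) m (exist _ (s, y) e)
  = over_map (projT2 d) m (exist _ (s, y) e').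
Proof. by subst d; congr (app _ _); apply: pull_cellP. Qed.

Lemma transpose_uniq (A : over X) (B : over Y) (k : over_hom A (push B)) :
  transpose (over_comp (counit B) (pull_hom f k)) = k.
Proof.
apply: over_homP => n a; apply: push_cellP => [|m s y e e'].
  by rewrite /= -(over_mapE k).
have e1 : act (did m) (projT1 (act s (over_map k n a))) = f m y.
  by rewrite act_id.
transitivity (over_map (projT2 (act s (over_map k n a))) m
                (exist _ (did m, y) e1)).
  exact: (@push_sec_eq B m _ (act s (over_map k n a))
            (app_act (over_map k) s a) m (did m) y).
by rewrite /=; congr (app _ _); apply: pull_cellP; rewrite /= dcompd1.
Qed.

(** [push] is right adjoint to [pull f]: [counit B] is a universal arrow from
    [pull f] to [B]. *)
Lemma push_universal (A : over X) (B : over Y) (h : over_hom (pull f A) B) :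
  exists! k : over_hom A (push B), over_comp (counit B) (pull_hom f k) = h.
Proof.
exists (transpose h); split=> [|k <-]; first exact: transposeK.
exact: transpose_uniq.
Qed.

End Pushforward.

(* Main.v *)
Require Import Defs.
From mathcomp Require Import all_boot zify.
From Stdlib Require Import ProofIrrelevance.

Set Implicit Arguments.
Unset Strict Implicit.
Unset Printing Implicit Defensive.

(** Write [I] for the 1-simplex.  For [A] inside [B] and an end [e] of [I], call
    the union of [A x I] and [B x {e}] the open box.  The horn is a deformation
    retract of the simplex: depending on [k], moving every vertex to its minimum
    with [k] or to its maximum with [k] gives a homotopy ([contract]) that
    preserves the horn, is the identity at one end [e] and lands in the horn at
    the other end.  Let [P] be the pullback of [f] along a simplex of [X] and [P']
    the part of [P] over the horn.  Lifting the homotopy along [f], that is,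
    filling an open box with empty [A], deforms [P] into [P'] ([deform]).  A map
    defined on [P'] composes with this deformation to a map on the open box of
    [P'] in [P] at the opposite end; filling that box along [g] and restricting to
    the end [e] extends the map from [P'] to [P] ([pull_horn_filler]).  By
    adjunction this is a horn filler for the pushforward of [g] ([transpose_comp]).

    It remains to fill every open box by means of the given horn fillers
    ([open_box_filler]) without choices.  The cylinder is obtained from the open
    box by attaching horns: each nondegenerate simplex [b] of [B] outside [A], of
    dimension [m], contributes the [m+1] top simplices of its prism, each attached
    along one horn.  Simplices of equal rank are attached simultaneously, and the
    filler of each of them is the one that the given function returns, so nothing
    is chosen.  Excluded middle decides membership in [A] and nondegeneracy;
    definite description turns the relation between a simplex and its prescribed
    image into a map.  By the Eilenberg-Zilber lemma ([nondeg_exists],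
    [nondeg_dim], [nondeg_uniq]) every simplex is reached, and in only one way, which
    makes this relation functional. *)

(** * Monotone maps *)

Lemma clamp_mono m n (h : 'I_m.+1 -> nat) :
  {homo h : i j / (i <= j)%N >-> i <= j} ->
  monotone [ffun i => inord (minn (h i) n) : 'I_n.+1].
Proof.
move=> hm; apply/forallP => i; apply/forallP => j; apply/implyP => ij.
by rewrite !ffunE !inordK; have := hm _ _ ij; lia.
Qed.

(** Values are truncated at [n], so that no bound has to be supplied. *)
Definition clamp m n (h : 'I_m.+1 -> nat)
    (hm : {homo h : i j / (i <= j)%N >-> i <= j}) : delta m n :=
  Delta (clamp_mono n hm).

Lemma clampE m n (h : 'I_m.+1 -> nat) (hm : {homo h : i j / (i <= j)%N >-> i <= j}) i :
  clamp n hm i = minn (h i) n :> nat.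
Proof. by rewrite ffunE inordK //; lia. Qed.

Definition surj m n (s : delta m n) : Prop := forall i, exists q, s q = i.

Lemma bump_mono n j : {homo (fun i : 'I_n.+1 => bump j i) : x y / (x <= y)%N >-> x <= y}.
Proof. by move=> x y; rewrite /bump; lia. Qed.

Lemma unbump_mono n j : {homo (fun i : 'I_n.+1 => unbump j i) : x y / (x <= y)%N >-> x <= y}.
Proof. by move=> x y; rewrite /unbump; lia. Qed.

(** For [j] in range these are the usual coface and codegeneracy operators; they
    are indexed by all of [nat] to keep arithmetic on indices free of casts. *)
Definition face n (j : nat) : delta n n.+1 := clamp n.+1 (@bump_mono n j).
Definition codeg n (j : nat) : delta n.+1 n := clamp n (@unbump_mono n.+1 j).

Lemma faceE n j (i : 'I_n.+1) : face n j i = bump j i :> nat.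
Proof. by rewrite clampE /bump; have := ltn_ord i; lia. Qed.

Lemma codegE n j (i : 'I_n.+2) : codeg n j i = minn (unbump j i) n :> nat.
Proof. exact: clampE. Qed.

Lemma faceK m n (j : 'I_n.+2) (s : delta m n.+1) : (forall q, s q != j) ->
  dcomp (face n j) (dcomp (codeg n j) s) = s.
Proof.
move=> sj; apply: deltaP => q; apply: ord_inj.
rewrite !dcompE faceE codegE /bump /unbump.
have /eqP := sj q; have := ltn_ord (s q); have := ltn_ord j.
move=> hj hs ne; have {ne} : s q <> j :> nat by move=> e; apply/ne/val_inj.
lia.
Qed.

(** A set-theoretic section of a monotone surjection is automatically monotone,
    so its value at one point can be prescribed. *)
Lemma surj_section m n (s : delta m n) (q0 : 'I_m.+1) : surj s ->
  exists2 d : delta n m, dcomp s d = did n & d (s q0) = q0.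
Proof.
move=> ss.
have /fin_all_exists[h hs] : forall i, exists q, s q = i /\ (i = s q0 -> q = q0).
  move=> i; case: (eqVneq i (s q0)) => [->|ne]; first by exists q0.
  by have [q qi] := ss i; exists q; split=> // e; case/eqP: ne.
have hm : monotone [ffun i => h i].
  apply/forallP => i; apply/forallP => j; apply/implyP => ij; rewrite !ffunE.
  rewrite leqNgt; apply/negP => ji; have := delta_leq s (ltnW ji).
  rewrite (hs i).1 (hs j).1 => ji'.
  have e : i = j by apply: val_inj; apply/eqP; rewrite eqn_leq ij ji'.
  by rewrite e ltnn in ji.
exists (Delta hm); last by rewrite ffunE; apply: (hs _).2.
by apply: deltaP => i; rewrite dcompE didE ffunE (hs i).1.
Qed.

(** Strict monotonicity gains at least one at every step. *)
Lemma inj_ge_id n (s : delta n n) : injective s -> forall i : 'I_n.+1, i <= s i.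
Proof.
move=> si [i hi]; elim: i hi => [|i IH] //= hi.
have hi' : i < n.+1 by lia.
have := IH hi'; have := @delta_leq _ _ s (Ordinal hi') (Ordinal hi) (leqnSn i).
have /eqP : s (Ordinal hi') <> s (Ordinal hi) by move/si/(congr1 val) => /=; lia.
rewrite -val_eqE /=; lia.
Qed.

(** A section of [s] is injective, so [inj_ge_id] bounds [s] from above; it is
    also a two-sided inverse by finiteness, so [inj_ge_id] bounds [s] from below. *)
Lemma surj_endo n (s : delta n n) : surj s -> s = did n.
Proof.
move=> ss; have [d sd _] := surj_section ord0 ss.
have sdE i : s (d i) = i by rewrite -dcompE sd didE.
have dge := inj_ge_id (can_inj sdE).
have sinj : injective s := can_inj (canF_sym sdE).
apply: deltaP => i; apply: val_inj; rewrite didE; apply/eqP.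
rewrite eqn_leq (inj_ge_id sinj) andbT.
by have := delta_leq s (dge i); rewrite sdE.
Qed.

(** * Nondegenerate simplices *)

Section EilenbergZilber.
Variable B : sSet.

(** A simplex is nondegenerate when it is not pulled back from any simplex of
    smaller dimension, along an arbitrary operator and not only along a
    surjective one. *)
Definition nondeg m (b : B m) : Prop :=
  forall r (s : delta m r) (b' : B r), b = act s b' -> m <= r.

(** If [s] missed a vertex it would factor through a face, and [b] would come from
    a lower dimension. *)
Lemma nondeg_surj m (b b' : B m) (s : delta m m) :
  nondeg b -> b = act s b' -> surj s.
Proof.
move=> nb e i; case: (boolP [exists q, s q == i]) => [/existsP[q /eqP]|]; first by exists q.
rewrite negb_exists => /forallP si.
case: m b b' s nb e i si => [|m] b b' s nb e i si.
  by have := si ord0; rewrite !ord1.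
have := nb m (dcomp (codeg m i) s) (act (face m i) b').
by rewrite -act_comp faceK // => /(_ e); rewrite ltnn.
Qed.

Lemma nondeg_dim p m m' (b : B m) (b' : B m') (s : delta p m) (s' : delta p m') :
  nondeg b -> surj s -> act s b = act s' b' -> m <= m'.
Proof.
move=> nb ss e; have [d sd _] := surj_section ord0 ss.
by apply: (nb _ (dcomp s' d) b'); rewrite act_comp -e -act_comp sd act_id.
Qed.

(** For any section [d] of [s], [b] is the pullback of [b'] along [s' d], which
    must then be the identity.  As sections through any prescribed vertex exist,
    [s] and [s'] agree everywhere. *)
Lemma nondeg_uniq p m (b b' : B m) (s s' : delta p m) :
  nondeg b -> surj s -> act s b = act s' b' -> b = b' /\ s = s'.
Proof.
move=> nb ss e.
have sec d : dcomp s d = did m -> b = act (dcomp s' d) b' /\ dcomp s' d = did m.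
  move=> sd; have eb : b = act (dcomp s' d) b'.
    by rewrite act_comp -e -act_comp sd act_id.
  by split=> //; apply/surj_endo/nondeg_surj/eb.
split.
  have [d sd _] := surj_section ord0 ss.
  by have [-> ->] := sec d sd; rewrite act_id.
apply: deltaP => q; have [d sd dq] := surj_section q ss.
have [_ s'd] := sec d sd.
by rewrite -{2}dq -dcompE s'd didE.
Qed.

Hypothesis em : forall P : Prop, P \/ ~ P.

(** Descent on the dimension; excluded middle settles at each step whether the
    simplex comes from a smaller dimension. *)
Lemma nondeg_exists m (b : B m) :
  nondeg b \/ exists r (s : delta m r) (b' : B r), [/\ r < m, nondeg b' & b = act s b'].
Proof.
elim/ltn_ind: m b => m IH b.
case: (em (nondeg b)) => [|nb]; first by left.
right; case: (em (exists r, r < m /\ exists (s : delta m r) b', b = act s b')) => [|no].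
  case=> r [rm [s [b' e]]]; case: (IH r rm b') => [nb'|[r' [s' [b'' [r'r nb'' e']]]]].
    by exists r, s, b'.
  exists r', (dcomp s' s), b''; split=> //; first exact: ltn_trans rm.
  by rewrite act_comp -e'.
case: nb => r s b' e; rewrite leqNgt; apply/negP => rm; apply: no.
by exists r; split=> //; exists s, b'.
Qed.

End EilenbergZilber.

(** * Relative cell complexes built from horns *)

Record subobj (C : sSet) := Subobj {
  smem :> forall n, C n -> Prop;
  smem_act : forall m n (t : delta m n) (c : C n),
    smem c -> smem (act t c) }.

Section SubSimplicialSet.
Variables (C : sSet) (T : subobj C).

Definition sub_act m n (t : delta m n) (c : {c : C n | T n c}) : {c : C m | T m c} :=
  exist _ (act t (sval c)) (smem_act t (svalP c)).

Lemma sub_cellP n (c d : {c : C n | T n c}) : sval c = sval d -> c = d.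
Proof.
by case: c d => [c h] [d h'] /= cd; subst d; congr exist; apply: proof_irrelevance.
Qed.

Lemma sub_act_id n (c : {c : C n | T n c}) : sub_act (did n) c = c.
Proof. by apply: sub_cellP; apply: act_id. Qed.

Lemma sub_act_comp m n p (s : delta n p) (t : delta m n) (c : {c : C p | T p c}) :
  sub_act (dcomp s t) c = sub_act t (sub_act s c).
Proof. by apply: sub_cellP; apply: act_comp. Qed.

Definition sub_sset : sSet := SSet sub_act_id sub_act_comp.

Definition sub_incl : smap sub_sset C :=
  @SMap sub_sset C (fun _ c => sval c) (fun _ _ _ _ => erefl).

End SubSimplicialSet.

Lemma smap_eq (A B : sSet) (f g : smap A B) : f = g -> forall n (a : A n), f n a = g n a.
Proof. by move=> ->. Qed.

Section CellComplex.
Hypothesis dd :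
  forall (A : Type) (P : A -> Prop), (exists! a : A, P a) -> {a : A | P a}.

(** Definite description is applied here only, to the value of a map at a simplex. *)
Lemma smap_of_rel (A B : sSet) (R : forall n, A n -> B n -> Prop) :
  (forall n (a : A n), exists! b, R n a b) ->
  (forall m n (t : delta m n) a b, R n a b -> R m (act t a) (act t b)) ->
  {w : smap A B | forall n (a : A n), R n a (w n a)}.
Proof.
move=> Rf Rn; pose w n (a : A n) := sval (dd (Rf n a)).
have wR n (a : A n) : R n a (w n a) := svalP (dd (Rf n a)).
have wn m n (t : delta m n) (a : A n) : w m (act t a) = act t (w n a).
  have [b [_ bu]] := Rf m (act t a).
  by rewrite -(bu _ (wR m _)); apply/bu/Rn/wR.
by exists (SMap wn).
Qed.

Variables (C : sSet) (S : subobj C).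
Variables (J : Type) (dim : J -> nat) (dim_gt0 : forall j, 0 < dim j).
Variables (miss : forall j, 'I_(dim j).+1) (cell : forall j, C (dim j)).
Variable rank : J -> nat.

Lemma attach_act (T : subobj C) N m n (t : delta m n) (c : C n) :
  (T n c \/ exists j (s : delta n (dim j)), rank j = N /\ c = act s (cell j)) ->
  T m (act t c) \/
  exists j (s : delta m (dim j)), rank j = N /\ act t c = act s (cell j).
Proof.
case=> [h|[j [s [rj ->]]]]; first by left; apply: smem_act.
by right; exists j, (dcomp s t); rewrite act_comp.
Qed.

Definition attach (T : subobj C) N : subobj C := Subobj (@attach_act T N).

Fixpoint stage N : subobj C := if N is M.+1 then attach (stage M) M else S.

Lemma stage_le M N n (c : C n) : M <= N -> stage M n c -> stage N n c.
Proof.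
move=> MN h; rewrite -(subnK MN); elim: (N - M) => [|k IH] //=.
by left.
Qed.

(** The next four hypotheses say that [C] is obtained from [S] by attaching, rank
    by rank, the simplices [cell j] along the horns with missing face [miss j]:
    the horn of a cell is already there when the cell is attached, a simplex of the
    cell outside its horn is not in [S] and determines its cell, and everything is
    eventually reached. *)
Hypothesis horn_stage : forall j n (s : delta n (dim j)),
  in_horn (miss j) s -> stage (rank j) n (act s (cell j)).
Hypothesis base_horn : forall j n (s : delta n (dim j)),
  S n (act s (cell j)) -> in_horn (miss j) s.
Hypothesis cell_inj : forall j j' n (s : delta n (dim j)) (s' : delta n (dim j')),
  ~~ in_horn (miss j) s -> ~~ in_horn (miss j') s' ->
  act s (cell j) = act s' (cell j') ->
  existT (fun j => delta n (dim j)) j s = existT (fun j => delta n (dim j)) j' s'.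
Hypothesis stage_cover : forall n (c : C n), exists N, stage N n c.

(** Each cell meets the earlier stages exactly in its horn, so that a stage is
    the pushout of the previous one along a sum of horn inclusions. *)
Lemma stage_horn j N n (s : delta n (dim j)) :
  N <= rank j -> stage N n (act s (cell j)) -> in_horn (miss j) s.
Proof.
elim: N => [_|N IH NR]; first exact: base_horn.
case=> [|[j' [s' [rj' e]]]]; first exact/IH/ltnW.
case: (boolP (in_horn (miss j) s)) => // ns.
case: (boolP (in_horn (miss j') s')) => [hs'|ns'].
  case/negP: ns; apply: IH; first exact: ltnW.
  by rewrite e -rj'; apply: horn_stage.
have /(congr1 (fun w => rank (projT1 w))) /= := cell_inj ns ns' e.
by move=> r; rewrite r rj' ltnn in NR.
Qed.

Section Fill.
Variables (Z Y : sSet) (g : smap Z Y) (cg : horn_fillers g) (v : smap C Y).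

Definition lift_on (T : subobj C) : Type :=
  {u : smap (sub_sset T) Z | g \os u = v \os sub_incl T}.

Definition extends (T T' : subobj C) (u : lift_on T) (u' : lift_on T') : Prop :=
  forall n (c : C n) (h : T n c) (h' : T' n c),
    sval u' n (exist _ c h') = sval u n (exist _ c h).

Section Step.
Variables (N : nat) (u : lift_on (stage N)).

Lemma horn_mem j (jN : rank j = N) n (x : horn (miss j) n) :
  stage N n (act (val x) (cell j)).
Proof. by case: x => s hs /=; rewrite -jN; apply: horn_stage. Qed.

Lemma horn_map_act j (jN : rank j = N) m n (t : delta m n) (x : horn (miss j) n) :
  exist _ _ (horn_mem jN (act t x)) =
  act t (exist _ _ (horn_mem jN x) : sub_sset (stage N) n).
Proof. by apply: sub_cellP; rewrite /= act_comp. Qed.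

Definition horn_map j (jN : rank j = N) : smap (horn (miss j)) (sub_sset (stage N)) :=
  @SMap (horn (miss j)) (sub_sset (stage N)) (fun n x => exist _ _ (horn_mem jN x))
    (horn_map_act jN).

(** The lifting problem that attaching the cell [j] to the current stage poses. *)
Lemma horn_square j (jN : rank j = N) :
  g \os (sval u \os horn_map jN) = (v \os str (yoneda (cell j))) \os horn_incl (miss j).
Proof. by apply: smapP => n x; apply: (smap_eq (svalP u) (exist _ _ (horn_mem jN x))). Qed.

Definition fill j (jN : rank j = N) : smap (simplex (dim j)) Z :=
  sval (cg (dim_gt0 j) (horn_square jN)).

Lemma fill_horn j (jN : rank j = N) n (s : delta n (dim j)) (hs : in_horn (miss j) s) h :
  fill jN n s = sval u n (exist _ (act s (cell j)) h).
Proof.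
have [e _] := svalP (cg (dim_gt0 j) (horn_square jN)).
rewrite -[LHS](smap_eq (esym e) (exist _ s hs)) /=.
by congr (sval u n _); apply: sub_cellP.
Qed.

Lemma fill_over j (jN : rank j = N) n (s : delta n (dim j)) :
  g n (fill jN n s) = v n (act s (cell j)).
Proof.
have [_ e] := svalP (cg (dim_gt0 j) (horn_square jN)).
exact: (smap_eq e s).
Qed.

Lemma fill_eq j j' (jN : rank j = N) (jN' : rank j' = N) n (s : delta n (dim j)) s' :
  existT (fun j => delta n (dim j)) j s = existT (fun j => delta n (dim j)) j' s' ->
  fill jN n s = fill jN' n s'.
Proof.
move=> e; have aux w (wN : rank (projT1 w) = N) :
    existT (fun j => delta n (dim j)) j s = w -> fill jN n s = fill wN n (projT2 w).
  by move=> ew; subst w; rewrite /= (proof_irrelevance _ jN wN).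
exact: (aux (existT _ j' s') jN' e).
Qed.

(** Stated as a relation, the extended map is natural for trivial reasons; the
    geometry of the attachment enters only in the proof of functionality. *)
Definition step_rel n (c : sub_sset (stage N.+1) n) (z : Z n) : Prop :=
  (exists h : stage N n (sval c), z = sval u n (exist _ (sval c) h)) \/
  (exists j (jN : rank j = N) (s : delta n (dim j)),
     sval c = act s (cell j) /\ z = fill jN n s).

Lemma step_old_new n (c : C n) (h : stage N n c) j (jN : rank j = N) (s : delta n (dim j)) :
  c = act s (cell j) -> fill jN n s = sval u n (exist _ c h).
Proof.
move=> e; subst c; apply: fill_horn.
by apply: (stage_horn _ h); rewrite jN.
Qed.

Lemma step_rel_functional n (c : sub_sset (stage N.+1) n) : exists! z, step_rel c z.
Proof.
case: c => c h'; case: (h') => [h|[j [s [jN e]]]].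
  exists (sval u n (exist _ c h)); split=> [|z]; first by left; exists h.
  case=> /= [[h1 ->]|[j [jN [s [e ->]]]]]; last by rewrite (step_old_new h jN e).
  by congr (sval u n _); apply: sub_cellP.
exists (fill jN n s); split=> [|z]; first by right; exists j, jN, s.
case=> /= [[h ->]|[j' [jN' [s' [e' ->]]]]]; first exact: (step_old_new h jN e).
case: (boolP (in_horn (miss j) s)) => [hs|ns].
  have h : stage N n c by rewrite e -jN; apply: horn_stage.
  by rewrite (step_old_new h jN e) (step_old_new h jN' e').
case: (boolP (in_horn (miss j') s')) => [hs'|ns'].
  have h : stage N n c by rewrite e' -jN'; apply: horn_stage.
  by rewrite (step_old_new h jN e) (step_old_new h jN' e').
by apply: fill_eq; apply: cell_inj => //; rewrite -e.
Qed.

Lemma step_rel_natural m n (t : delta m n) (c : sub_sset (stage N.+1) n) z :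
  step_rel c z -> step_rel (act t c) (act t z).
Proof.
case=> [[h ->]|[j [jN [s [e ->]]]]]; [left|right].
  exists (smem_act t h); rewrite -app_act; congr (sval u m _).
  exact: sub_cellP.
by exists j, jN, (dcomp s t); rewrite -app_act /= e act_comp.
Qed.

Lemma stage_step : {u' : lift_on (stage N.+1) | extends u u'}.
Proof.
have [w wR] := smap_of_rel step_rel_functional step_rel_natural.
have wv : g \os w = v \os sub_incl (stage N.+1).
  apply: smapP => n c /=; case: (wR n c) => [[h ->]|[j [jN [s [-> ->]]]]].
    exact: (smap_eq (svalP u)).
  exact: fill_over.
exists (exist _ w wv) => n c h h' /=.
have [z [_ zu]] := step_rel_functional (exist _ c h' : sub_sset (stage N.+1) n).
by rewrite -(zu _ (wR n _)); apply: zu; left; exists h.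
Qed.

End Step.

Variable u : smap (sub_sset S) Z.
Hypothesis uv : g \os u = v \os sub_incl S.

Fixpoint stage_lift N : lift_on (stage N) :=
  if N is M.+1 then sval (stage_step (stage_lift M)) else exist _ u uv.

Lemma stage_lift_extends M N : M <= N -> extends (stage_lift M) (stage_lift N).
Proof.
move=> MN n c h; rewrite -(subnK MN); elim: (N - M) => [|k IH] h'.
  by congr (sval (stage_lift M) n _); apply: sub_cellP.
have hk : stage (k + M) n c by apply: (stage_le _ h); rewrite leq_addl.
by rewrite -(IH hk); apply: (svalP (stage_step (stage_lift (k + M)))).
Qed.

Definition stage_lift_rel n (c : C n) (z : Z n) : Prop :=
  exists N (h : stage N n c), z = sval (stage_lift N) n (exist _ c h).

Lemma stage_lift_rel_functional n (c : C n) : exists! z, stage_lift_rel c z.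
Proof.
have [N h] := stage_cover c.
exists (sval (stage_lift N) n (exist _ c h)); split=> [|_ [M [h' ->]]]; first by exists N, h.
case: (leqP M N) => [MN|/ltnW NM]; first exact: (stage_lift_extends MN).
exact/esym/(stage_lift_extends NM).
Qed.

Lemma stage_lift_rel_natural m n (t : delta m n) (c : C n) z :
  stage_lift_rel c z -> stage_lift_rel (act t c) (act t z).
Proof.
case=> N [h ->]; exists N, (smem_act t h); rewrite -app_act.
by congr (sval (stage_lift N) m _); apply: sub_cellP.
Qed.

(** The filler is built one stage at a time.  All the cells of a stage are filled
    simultaneously by the given function, hence without choosing anything. *)
Lemma cell_complex_filler : filler (sub_incl S) g u v.
Proof.
have [w wR] := smap_of_rel stage_lift_rel_functional stage_lift_rel_natural.
exists w; split; apply: smapP => n c /=.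
  have [z [_ zu]] := stage_lift_rel_functional (sval c).
  rewrite -(zu _ (wR n _)); apply: zu; exists 0, (svalP c).
  by congr (u n _); apply: sub_cellP.
case: (wR n c) => N [h ->].
exact: (smap_eq (svalP (stage_lift N))).
Qed.

End Fill.
End CellComplex.

(** * Cylinders *)

Lemma not_in_horn n (k : 'I_n.+1) m (s : delta m n) : ~~ in_horn k s ->
  forall y : nat, y <= n -> y <> k -> exists q, s q = y :> nat.
Proof.
rewrite negb_exists => /forallP h y yn yk.
have := h (inord y); rewrite negb_and => /orP[|].
  by rewrite negbK => /eqP e; case: yk; rewrite -e inordK.
by rewrite negb_forall => /existsP[q /negPn/eqP e]; exists q; rewrite e inordK.
Qed.

Lemma delta1_case m (t : delta m 1) q : t q = 0 :> nat \/ t q = 1 :> nat.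
Proof. by have := ltn_ord (t q); lia. Qed.

Lemma cut_mono n i :
  {homo (fun x : 'I_n.+1 => nat_of_bool (i < x)) : x y / (x <= y)%N >-> x <= y}.
Proof. by move=> x y; lia. Qed.

(** The operator sending the vertices up to [i] to [0] and the others to [1]. *)
Definition cut_at n (i : nat) : delta n 1 := clamp 1 (@cut_mono n i).

Lemma cutE n i (x : 'I_n.+1) : cut_at n i x = (i < x) :> nat.
Proof. by rewrite clampE; case: (_ < _). Qed.

Lemma shuffle_mono p m (s : delta p m) (t : delta p 1) :
  {homo (fun q => s q + t q) : x y / (x <= y)%N >-> x <= y}.
Proof. by move=> x y xy; rewrite leq_add // delta_leq. Qed.

(** Together with [codeg m i] and [cut_at m.+1 i], which embed the [m.+1]-simplex
    as the simplex on [(0,0),...,(i,0),(i,1),...,(m,1)] of the prism, this recovers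
    the coordinate in that simplex from the two projections [s] and [t]: a vertex
    of the path is determined by the sum of its coordinates. *)
Definition shuffle p m (s : delta p m) (t : delta p 1) : delta p m.+1 :=
  clamp m.+1 (@shuffle_mono p m s t).

Lemma shuffleE p m (s : delta p m) (t : delta p 1) q : shuffle s t q = s q + t q :> nat.
Proof. by rewrite clampE; have := ltn_ord (s q); have := ltn_ord (t q); lia. Qed.

(** This holds exactly when the simplex [(s, t)] of the prism lies in the top
    simplex on [(0,0),...,(i,0),(i,1),...,(m,1)]. *)
Definition crosses_at m p (s : delta p m) (t : delta p 1) (i : nat) : Prop :=
  forall q, (t q = 0 :> nat -> s q <= i) /\ (t q = 1 :> nat -> i <= s q).

Lemma crosses_at_comp m n p (r : delta m n) (s : delta p m) (t : delta p 1) (i : 'I_m.+1) :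
  crosses_at s t i -> crosses_at (dcomp r s) t (r i).
Proof.
by move=> h q; rewrite dcompE; split=> tq; apply: delta_leq; [apply (h q).1|apply (h q).2].
Qed.

Lemma shuffle_codeg p m (s : delta p m) (t : delta p 1) (i : nat) :
  crosses_at s t i -> dcomp (codeg m i) (shuffle s t) = s.
Proof.
move=> h; apply: deltaP => q; apply: ord_inj.
rewrite dcompE codegE shuffleE /unbump; have [h0 h1] := h q.
have := ltn_ord (s q); case: (delta1_case t q) => tq.
  by have := h0 tq; lia.
by have := h1 tq; lia.
Qed.

Lemma shuffle_cut p m (s : delta p m) (t : delta p 1) (i : nat) :
  crosses_at s t i -> dcomp (cut_at m.+1 i) (shuffle s t) = t.
Proof.
move=> h; apply: deltaP => q; apply: ord_inj.
rewrite dcompE cutE shuffleE; have [h0 h1] := h q.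
case: (delta1_case t q) => tq.
  by have := h0 tq; lia.
by have := h1 tq; lia.
Qed.

Lemma codeg_crosses_at p m (i : nat) (s : delta p m.+1) : i <= m ->
  crosses_at (dcomp (codeg m i) s) (dcomp (cut_at m.+1 i) s) i.
Proof.
by move=> im q; rewrite !dcompE codegE cutE /unbump; have := ltn_ord (s q); lia.
Qed.

Lemma shuffle_eta p m (i : nat) (s : delta p m.+1) : i <= m ->
  shuffle (dcomp (codeg m i) s) (dcomp (cut_at m.+1 i) s) = s.
Proof.
move=> im; apply: deltaP => q; apply: ord_inj.
by rewrite shuffleE !dcompE codegE cutE /unbump; have := ltn_ord (s q); lia.
Qed.

Section Cylinder.
Variable B : sSet.

Definition cyl_act m n (t : delta m n) (x : B n * delta n 1) : B m * delta m 1 :=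
  (act t x.1, dcomp x.2 t).

Lemma cyl_act_id n (x : B n * delta n 1) : cyl_act (did n) x = x.
Proof. by case: x => b t; rewrite /cyl_act act_id dcompd1. Qed.

Lemma cyl_act_comp m n p (s : delta n p) (t : delta m n) (x : B p * delta p 1) :
  cyl_act (dcomp s t) x = cyl_act t (cyl_act s x).
Proof. by rewrite /cyl_act act_comp dcompA. Qed.

Definition cyl : sSet := SSet cyl_act_id cyl_act_comp.

Variables (A : subobj B) (e : bool).

Definition open_box_mem n (x : cyl n) : Prop :=
  A n x.1 \/ forall q, x.2 q = e :> nat.

Lemma open_box_act m n (t : delta m n) (x : cyl n) :
  open_box_mem x -> open_box_mem (act t x).
Proof. by case=> h; [left; apply: smem_act|right=> q; rewrite dcompE]. Qed.

Definition open_box : subobj cyl := Subobj open_box_act.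

(** A top simplex of the prism over a nondegenerate simplex outside [A]; [pstep]
    is the place where its path passes from the bottom to the top. *)
Record prism := Prism {
  pdim : nat;
  pbase : B pdim;
  pbase_nondeg : nondeg pbase;
  pbase_new : ~ A pdim pbase;
  pstep : 'I_pdim.+1 }.

Definition prism_dim (j : prism) : nat := (pdim j).+1.

Definition prism_cell (j : prism) : cyl (prism_dim j) :=
  (act (codeg (pdim j) (pstep j)) (pbase j), cut_at (pdim j).+1 (pstep j)).

(** Successive top simplices of a prism share a face.  When the open box contains
    the bottom ([e] is false) they are attached from the last to the first, and
    the new face omits the vertex [(i,0)], whose index is [i]; when it contains
    the top, they are attached from the first to the last, and the new face omits
    [(i,1)], whose index is [i+1]. *)
Definition prism_miss (j : prism) : 'I_(prism_dim j).+1 := inord (pstep j + e).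

(** The square makes every prism over a simplex of dimension below [m] precede
    those over dimension [m]: the second summand is at most [m], and [m^2 + m] is
    less than [(m+1)^2]. *)
Definition step_rank m i := m ^ 2 + (if e then i else m - i).

Definition prism_rank (j : prism) : nat := step_rank (pdim j) (pstep j).

Notation pstage := (stage open_box prism_cell prism_rank).

Lemma prism_missE j : prism_miss j = pstep j + e :> nat.
Proof.
by rewrite inordK //; have := ltn_ord (pstep j); rewrite /prism_dim; case: (e) => /=; lia.
Qed.

Lemma prism_act (j : prism) n (s : delta n (prism_dim j)) :
  act s (prism_cell j) = (act (dcomp (codeg (pdim j) (pstep j)) s) (pbase j),
                          dcomp (cut_at (pdim j).+1 (pstep j)) s) :> cyl n.
Proof. by rewrite /= /cyl_act /= act_comp. Qed.

(** The two vertices with the same first coordinate are [i] and [i+1], and only one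
    of them is the missing one. *)
Lemma prism_surj (j : prism) n (s : delta n (prism_dim j)) :
  ~~ in_horn (prism_miss j) s -> surj (dcomp (codeg (pdim j) (pstep j)) s).
Proof.
move=> /not_in_horn ns x; have xm := ltn_ord x; have im := ltn_ord (pstep j).
have [q sq] : exists q, s q =
    (if x < pstep j then x : nat else if pstep j < x then x.+1 else pstep j + ~~ e) :> nat.
  by apply: ns; rewrite ?prism_missE /prism_dim; case: (e) => /=; case: ifP; try case: ifP; lia.
exists q; apply: ord_inj; rewrite dcompE codegE sq /unbump.
by case: (e) => /=; case: ifP; try case: ifP; lia.
Qed.

Lemma prism_base_horn (j : prism) n (s : delta n (prism_dim j)) :
  open_box n (act s (prism_cell j)) -> in_horn (prism_miss j) s.
Proof.
rewrite prism_act => h; case: (boolP (in_horn (prism_miss j) s)) => // ns.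
case: h => /= [h|h].
  have [d sd _] := surj_section ord0 (prism_surj ns).
  by case: (@pbase_new j); have := smem_act d h; rewrite -act_comp sd act_id.
have im := ltn_ord (pstep j).
have [q sq] : exists q, s q = pstep j + ~~ e :> nat.
  by apply: (not_in_horn ns); rewrite ?prism_missE /prism_dim; case: (e) => /=; lia.
have hq : dcomp (cut_at (pdim j).+1 (pstep j)) s q = e :> nat := h q.
by move: hq; rewrite dcompE cutE sq; case: (e) => /=; lia.
Qed.

(** The vertex of a top simplex at [i + ~~ e], which is the neighbour of the
    missing vertex, is the first one on the top or the last one on the bottom, so
    that its first coordinate bounds every other admissible step. *)
Lemma prism_step_le (j j' : prism) n
  (s : delta n (prism_dim j)) (s' : delta n (prism_dim j')) q :
  s q = pstep j + ~~ e :> nat ->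
  codeg (pdim j) (pstep j) (s q) = codeg (pdim j') (pstep j') (s' q) :> nat ->
  cut_at (pdim j).+1 (pstep j) (s q) = cut_at (pdim j').+1 (pstep j') (s' q) :> nat ->
  if e then pstep j <= pstep j' else pstep j' <= pstep j.
Proof.
rewrite !codegE !cutE /unbump => ->.
have := ltn_ord (pstep j); have := ltn_ord (pstep j'); have := ltn_ord (s' q).
rewrite /prism_dim.
by case: (e) => /=; lia.
Qed.

(** A simplex outside the horn projects onto all of [b], so the Eilenberg-Zilber
    lemma recovers [b]; the step and the coordinate are then read off from the two
    projections. *)
Lemma prism_inj (j j' : prism) n (s : delta n (prism_dim j)) (s' : delta n (prism_dim j')) :
  ~~ in_horn (prism_miss j) s -> ~~ in_horn (prism_miss j') s' ->
  act s (prism_cell j) = act s' (prism_cell j') ->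
  existT (fun j => delta n (prism_dim j)) j s = existT (fun j => delta n (prism_dim j)) j' s'.
Proof.
move=> ns ns'; rewrite !prism_act => E.
have Eb := congr1 fst E; have Et := congr1 snd E; move: Eb Et => /= Eb Et {E}.
have ss := prism_surj ns; have ss' := prism_surj ns'.
have dd : pdim j = pdim j'.
  apply/eqP; rewrite eqn_leq (nondeg_dim (@pbase_nondeg j) ss Eb).
  exact: (nondeg_dim (@pbase_nondeg j') ss' (esym Eb)).
case: j j' s s' ns ns' Eb Et ss ss' dd => [m b nb nA i] [m' b' nb' nA' i'] s s' ns ns'.
move=> /= Eb Et ss ss' dd; subst m'.
have [eb es] := nondeg_uniq nb ss Eb; subst b'.
have im := ltn_ord i; have im' := ltn_ord i'.
have ii : i = i'.
  apply: ord_inj; apply/eqP; rewrite eqn_leq.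
  have [q sq] : exists q, s q = i + ~~ e :> nat.
    by apply: (not_in_horn ns); rewrite ?prism_missE /prism_dim /=; case: (e) => /=; lia.
  have [q' sq'] : exists q, s' q = i' + ~~ e :> nat.
    by apply: (not_in_horn ns'); rewrite ?prism_missE /prism_dim /=; case: (e) => /=; lia.
  have pw q0 : codeg m i (s q0) = codeg m i' (s' q0) by rewrite -!dcompE es.
  have pt q0 : cut_at m.+1 i (s q0) = cut_at m.+1 i' (s' q0) by rewrite -!dcompE Et.
  have := @prism_step_le (Prism nb nA i) (Prism nb' nA' i') n s s' q sq
    (congr1 _ (pw q)) (congr1 _ (pt q)).
  have := @prism_step_le (Prism nb' nA' i') (Prism nb nA i) n s' s q' sq'
    (congr1 _ (esym (pw q'))) (congr1 _ (esym (pt q'))).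
  by case: (e) => /= -> ->.
subst i'; rewrite (proof_irrelevance _ nb' nb) (proof_irrelevance _ nA' nA).
congr existT; rewrite -[s](@shuffle_eta _ _ i) // -[s'](@shuffle_eta _ _ i) //.
by rewrite es Et.
Qed.

Hypothesis em : forall P : Prop, P \/ ~ P.

Lemma step_rank_lt m i m' i' : i <= m -> m < m' -> step_rank m i < step_rank m' i'.
Proof.
move=> im mm; have h : m ^ 2 + m < m' ^ 2 by rewrite !expnS !expn0; nia.
by rewrite /step_rank; case: (e); lia.
Qed.

Lemma stage_crossing_nondeg m (b : B m) (i : nat) p (s : delta p m) (t : delta p 1) :
  nondeg b -> i <= m -> crosses_at s t i -> pstage (step_rank m i).+1 p (act s b, t).
Proof.
move=> nb im h; case: (em (A m b)) => [Ab|nA].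
  by apply: (@stage_le _ _ _ _ _ _ 0) => //; left; apply: smem_act.
right; exists (Prism nb nA (Ordinal (im : i < m.+1))), (shuffle s t); split=> //.
by rewrite prism_act /= shuffle_codeg // shuffle_cut.
Qed.

(** A degenerate [b] causes no harm: it comes from a lower dimension, hence from an
    earlier stage, and operators preserve the condition [crosses_at]. *)
Lemma stage_crossing m (b : B m) (i : nat) p (s : delta p m) (t : delta p 1) :
  i <= m -> crosses_at s t i -> pstage (step_rank m i).+1 p (act s b, t).
Proof.
move=> im h; case: (nondeg_exists em b) => [nb|[r [s' [b' [rm nb' ->]]]]].
  exact: stage_crossing_nondeg.
pose i0 := Ordinal (im : i < m.+1).
have := stage_crossing_nondeg nb' (ltn_ord (s' i0) : s' i0 <= r)
  (@crosses_at_comp _ _ _ s' s t i0 h).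
rewrite act_comp; apply: stage_le; apply/leqW/step_rank_lt => //.
by rewrite -ltnS.
Qed.

(** A simplex of the horn omits a vertex other than the missing one.  If that is
    the neighbour of the missing vertex, the simplex lies in the previously
    attached top simplex of the same prism, or in the end [e] when there is none;
    otherwise it lies over a proper face of [b]. *)
Lemma prism_horn_stage (j : prism) n (s : delta n (prism_dim j)) :
  in_horn (prism_miss j) s -> pstage (prism_rank j) n (act s (prism_cell j)).
Proof.
rewrite prism_act => /existsP[y /andP[/eqP ym /forallP sy]].
have {}ym : y <> pstep j + e :> nat by rewrite -prism_missE => /val_inj.
have {}sy q : s q <> y :> nat by move=> /val_inj e'; have := sy q; rewrite e' eqxx.
case: j s y ym sy => m b nb nA i; rewrite /prism_dim /= => s y ym sy.
have im := ltn_ord i; have yn := ltn_ord y.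
set t := dcomp (cut_at _ _) s; set r := dcomp (codeg _ _) s.
have h : crosses_at r t i by apply: codeg_crosses_at.
case: (eqVneq (y : nat) (i + ~~ e)) => [yi|yi].
  case: (eqVneq (i : nat) (if e then 0 else m)) => [i0|i0].
    apply: (@stage_le _ _ _ _ _ _ 0) => //; right=> q; rewrite -[_.2]/t dcompE cutE.
    have := sy q; have := ltn_ord (s q); move: yi i0; case: (e) => /=; lia.
  pose i' := if e then i.-1 else i.+1.
  have -> : prism_rank (Prism nb nA i) = (step_rank m i').+1.
    by rewrite /prism_rank /step_rank /i' /=; move: i0; case: (e) => /=; lia.
  apply: stage_crossing; first by rewrite /i'; move: i0; case: (e) => /=; lia.
  move=> q; rewrite !dcompE codegE cutE /unbump.
  have := sy q; have := ltn_ord (s q); move: yi i0; rewrite /i'; case: (e) => /=; lia.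
have {}yi : y <> i :> nat /\ y <> i.+1 :> nat.
  by move: ym yi; case: (e) => /=; lia.
have rE q : r q = minn (unbump i (s q)) m :> nat by rewrite /r dcompE codegE.
case: m b nb nA i s y ym sy im yn t r h yi rE => [|m] b nb nA i s y ym sy im yn t r h yi rE.
  by lia.
pose y' := if y < i then y : nat else y.-1.
have ry : dcomp (face m y') (dcomp (codeg m y') r) = r.
  have y'm : y' < m.+2 by rewrite /y'; case: ifP; lia.
  apply: (@faceK _ _ (Ordinal y'm)) => q; apply/eqP => /(congr1 val) /=.
  rewrite rE /unbump /y'; have := sy q; have := ltn_ord (s q).
  by case: ifP; lia.
rewrite -ry act_comp.
have := stage_crossing (act (face m y') b)
  (ltn_ord (codeg m y' i) : codeg m y' i <= m)
  (crosses_at_comp (codeg m y') h).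
by apply: stage_le; apply: (@step_rank_lt _ _ m.+1 i) => //; rewrite -ltnS.
Qed.

(** The step is the first vertex sent to [1], or the last vertex if there is none. *)
Lemma prism_cover n (x : cyl n) : exists N, pstage N n x.
Proof.
case: x => b t.
have exi : exists i, (n <= i) || (t (inord i) == 1 :> nat) by exists n; rewrite leqnn.
case: (ex_minnP exi) => i hi imin.
exists (step_rank n i).+1; rewrite -[b]act_id; apply: stage_crossing.
  by apply: imin; rewrite leqnn.
move=> q; rewrite didE; split=> tq.
  rewrite leqNgt; apply/negP => iq; have := ltn_ord q.
  case/orP: hi => [|/eqP ti]; first lia.
  have := @delta_leq _ _ t (inord i) q; rewrite inordK; last by have := ltn_ord q; lia.
  by rewrite ti tq => /(_ (ltnW iq)).
by apply: imin; rewrite inord_val tq eqxx orbT.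
Qed.

Hypothesis dd :
  forall (A : Type) (P : A -> Prop), (exists! a : A, P a) -> {a : A | P a}.

Lemma open_box_filler (Z Y : sSet) (g : smap Z Y) (cg : horn_fillers g)
  (u : smap (sub_sset open_box) Z) (v : smap cyl Y) :
  g \os u = v \os sub_incl open_box -> filler (sub_incl open_box) g u v.
Proof.
exact: (cell_complex_filler dd (fun j => ltn0Sn (pdim j) : 0 < prism_dim j)
  prism_horn_stage prism_base_horn prism_inj prism_cover cg).
Qed.

End Cylinder.

(** * Pulling back a horn along a fibration *)

Section Contraction.
Variables (n : nat) (k : 'I_n.+1) (e : bool).

(** For [e] true the homotopy ends at the identity and starts at the minimum with
    [k]; for [e] false it starts at the identity and ends at the maximum with
    [k]. *)
Definition contract_val m (x : delta m n) (t : delta m 1) (i : 'I_m.+1) : nat :=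
  if t i == e :> nat then x i : nat else if e then minn (x i) k else maxn (x i) k.

Lemma contract_mono m (x : delta m n) (t : delta m 1) :
  {homo contract_val x t : i j / (i <= j)%N >-> i <= j}.
Proof.
move=> i j ij; have xij := delta_leq x ij; have tij := delta_leq t ij.
rewrite /contract_val; case: (delta1_case t i) tij => ->; case: (delta1_case t j) => ->;
  by case: (e) => /=; lia.
Qed.

Definition contract m (x : delta m n) (t : delta m 1) : delta m n :=
  clamp n (contract_mono x t).

Lemma contractE m (x : delta m n) (t : delta m 1) i :
  contract x t i = contract_val x t i :> nat.
Proof.
rewrite clampE /contract_val; have := ltn_ord (x i); have := ltn_ord k.
by case: ifP => _; case: (e); lia.
Qed.

Lemma contract_act m p (s : delta p m) (x : delta m n) (t : delta m 1) :
  contract (dcomp x s) (dcomp t s) = dcomp (contract x t) s.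
Proof.
apply: deltaP => i; apply: ord_inj.
by rewrite dcompE !contractE /contract_val !dcompE.
Qed.

Lemma contract_id m (x : delta m n) (t : delta m 1) :
  (forall i, t i = e :> nat) -> contract x t = x.
Proof.
by move=> te; apply: deltaP => i; apply: ord_inj; rewrite contractE /contract_val te eqxx.
Qed.

(** The homotopy only adds the vertex [k], and the face opposite to [k] is the one
    that the horn leaves out. *)
Lemma contract_horn m (x : delta m n) (t : delta m 1) :
  in_horn k x -> in_horn k (contract x t).
Proof.
case/existsP => j /andP[jk /forallP xj]; apply/existsP; exists j; rewrite jk /=.
apply/forallP => i; have := xj i; move: jk.
rewrite -!(inj_eq val_inj) /= contractE /contract_val.
by case: ifP => _; case: (e); lia.
Qed.

(** Moved to the end, the simplex misses the last vertex if [k < n], and the first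
    one if [0 < k]. *)
Lemma contract_end m (x : delta m n) (t : delta m 1) :
  (if e then k < n else 0 < k) -> (forall i, t i = ~~ e :> nat) ->
  in_horn k (contract x t).
Proof.
move=> ke te; apply/existsP; exists (if e then ord_max else ord0).
rewrite -(inj_eq val_inj) /=; have := ltn_ord k => kn.
apply/andP; split; first by move: ke; case: (e) => /=; lia.
apply/forallP => i; rewrite -(inj_eq val_inj) /= contractE /contract_val te.
by have := ltn_ord (x i); move: ke; case: (e) => /=; lia.
Qed.

End Contraction.

Lemma const1_mono m (e : bool) :
  {homo (fun _ : 'I_m.+1 => e : nat) : i j / (i <= j)%N >-> i <= j}.
Proof. by []. Qed.

Definition const1 m (e : bool) : delta m 1 := clamp 1 (@const1_mono m e).

Lemma const1E m (e : bool) i : const1 m e i = e :> nat.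
Proof. by rewrite clampE; case: e. Qed.

Lemma at_end_act (e : bool) (B : sSet) m p (t : delta m p) (b : B p) :
  (act t b, const1 m e) = act t ((b, const1 p e) : cyl B p).
Proof.
have -> : const1 m e = dcomp (const1 p e) t; last by [].
by apply: deltaP => i; apply: ord_inj; rewrite dcompE !const1E.
Qed.

Definition at_end (e : bool) (B : sSet) : smap B (cyl B) :=
  @SMap B (cyl B) (fun m b => (b, const1 m e)) (@at_end_act e B).

Section HornPullback.
Hypothesis em : forall P : Prop, P \/ ~ P.
Hypothesis dd :
  forall (A : Type) (P : A -> Prop), (exists! a : A, P a) -> {a : A | P a}.

Variables (X Y : sSet) (f : smap Y X) (cf : horn_fillers f).
Variables (n : nat) (k : 'I_n.+1) (x : smap (simplex n) X).

Lemma horn_over_subproof :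
  str (Over x) \os horn_incl k = str (Over (x \os horn_incl k)).
Proof. by []. Qed.

Definition horn_over : over_hom (Over (x \os horn_incl k)) (Over x) :=
  exist _ (horn_incl k) horn_over_subproof.

Variables (e : bool) (ke : if e then k < n else 0 < k).

Notation P := (pull f (Over x)).
Notation P' := (pull f (Over (x \os horn_incl k))).

Lemma empty_act m p (t : delta m p) (c : P p) : False -> False.
Proof. by []. Qed.

Definition empty_sub : subobj P := @Subobj P (fun _ _ => False) empty_act.

Lemma contract_cyl_act m p (t : delta m p) (c : cyl P p) :
  contract k e (sval (act t c).1).1 (act t c).2 = dcomp (contract k e (sval c.1).1 c.2) t.
Proof. exact: contract_act. Qed.

Definition contract_cyl : smap (cyl P) (simplex n) :=
  @SMap (cyl P) (simplex n) (fun _ c => contract k e (sval c.1).1 c.2) contract_cyl_act.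

Definition end_proj : smap (sub_sset (open_box empty_sub e)) Y :=
  @SMap (sub_sset (open_box empty_sub e)) Y (fun _ c => (sval (sval c).1).2)
    (fun _ _ _ _ => erefl).

Lemma end_proj_square :
  f \os end_proj = (x \os contract_cyl) \os sub_incl (open_box empty_sub e).
Proof.
apply: smapP => m [[c t] [//|te]] /=.
by rewrite contract_id // -(svalP c).
Qed.

(** The homotopy of the simplex lifted along [f] to [P], starting from the
    projection to [Y] at the end where it is the identity. *)
Definition contract_lift :
    filler (sub_incl (open_box empty_sub e)) f end_proj (x \os contract_cyl) :=
  open_box_filler em dd cf end_proj_square.

Lemma contract_lift_over m (c : cyl P m) :
  f m (sval contract_lift m c) = x m (contract k e (sval c.1).1 c.2).
Proof. by have [_ E] := svalP contract_lift; apply: (smap_eq E). Qed.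

Lemma contract_lift_end m (c : cyl P m) : (forall i, c.2 i = e :> nat) ->
  sval contract_lift m c = (sval c.1).2.
Proof.
move=> h; have [E _] := svalP contract_lift.
exact: (smap_eq E (exist _ c (or_intror h))).
Qed.

Definition deform_cell m (c : cyl P m) : P m :=
  exist _ (contract k e (sval c.1).1 c.2, sval contract_lift m c)
    (esym (contract_lift_over c)).

Lemma deform_act m p (t : delta m p) (c : cyl P p) :
  deform_cell (act t c) = act t (deform_cell c).
Proof. by apply: pull_cellP; rewrite /= app_act contract_act. Qed.

Definition deform : smap (cyl P) P := SMap deform_act.

Lemma over_horn_act m p (t : delta m p) (c : P p) :
  in_horn k (sval c).1 -> in_horn k (sval (act t c)).1.
Proof. exact: in_horn_act. Qed.

Definition over_horn : subobj P :=
  @Subobj P (fun _ c => is_true (in_horn k (sval c).1)) over_horn_act.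

Lemma deform_in_horn m (c : sub_sset (open_box over_horn (~~ e)) m) :
  in_horn k (sval (deform m (sval c))).1.
Proof.
case: c => [[c t] [h|h]] /=; first exact: contract_horn.
exact: contract_end.
Qed.

(** On the open box of [over_horn] at the end opposite to [e], the deformation
    takes values over the horn: on [A x I] because the homotopy preserves the
    horn, at the end because the homotopy lands in it. *)
Definition deform_box_cell m (c : sub_sset (open_box over_horn (~~ e)) m) : P' m :=
  exist _ (exist (fun s => in_horn k s) (sval (deform m (sval c))).1 (deform_in_horn c)
             : horn k m, (sval (deform m (sval c))).2)
    (svalP (deform m (sval c))).

Lemma deform_box_act m p (t : delta m p) (c : sub_sset (open_box over_horn (~~ e)) p) :
  deform_box_cell (act t c) = act t (deform_box_cell c).
Proof.
apply: pull_cellP; rewrite /= app_act; congr pair.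
by apply: val_inj; apply: contract_act.
Qed.

Definition deform_box : smap (sub_sset (open_box over_horn (~~ e))) P' :=
  SMap deform_box_act.

(** The lift [w] of the composite of [u] with the deformation, restricted to the
    end where the deformation is the identity, extends [u] itself. *)
Lemma pull_horn_filler_end (E W : sSet) (g : smap E W) (cg : horn_fillers g)
  (u : smap P' E) (v : smap P W) :
  g \os u = v \os over_map (pull_hom f horn_over) ->
  filler (over_map (pull_hom f horn_over)) g u v.
Proof.
move=> uv.
have sq : g \os (u \os deform_box) = (v \os deform) \os sub_incl (open_box over_horn (~~ e)).
  apply: smapP => m c; rewrite [LHS](smap_eq uv (deform_box m c)) /=.
  by congr (v m _); apply: pull_cellP.
have [w [wu wv]] := open_box_filler em dd cg sq.
exists (w \os at_end e P); split; apply: smapP => m c.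
  have h : open_box over_horn (~~ e) m (at_end e P m (over_map (pull_hom f horn_over) m c)).
    by left; case: c => [[[s hs] y] ?].
  rewrite [LHS](smap_eq wu (exist _ _ h)) /=; congr (u m _); apply: pull_cellP => /=.
  case: c h => [[[s hs] y] c] h /=; congr pair; last first.
    by rewrite contract_lift_end //; apply: const1E.
  by apply: val_inj; apply: contract_id (const1E e).
rewrite [LHS](smap_eq wv (at_end e P m c)) /=; congr (v m _); apply: pull_cellP => /=.
rewrite contract_id; last exact: const1E.
by rewrite contract_lift_end; [case: c => [[]]|exact: const1E].
Qed.

End HornPullback.

(** One of the two contractions is always available: the minimum if [k < n], and
    otherwise the maximum, since then [k = n] is positive. *)
Lemma pull_horn_filler
  (em : forall P : Prop, P \/ ~ P)
  (dd : forall (A : Type) (P : A -> Prop), (exists! a : A, P a) -> {a : A | P a})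
  (X Y : sSet) (f : smap Y X) (cf : horn_fillers f)
  (n : nat) (k : 'I_n.+1) (n_gt0 : 0 < n) (x : smap (simplex n) X)
  (E W : sSet) (g : smap E W) (cg : horn_fillers g)
  (u : smap (pull f (Over (x \os horn_incl k))) E) (v : smap (pull f (Over x)) W) :
  g \os u = v \os over_map (pull_hom f (horn_over k x)) ->
  filler (over_map (pull_hom f (horn_over k x))) g u v.
Proof.
apply: (@pull_horn_filler_end em dd _ _ f cf n k x (k < n)) cg _ _.
by case: ltnP => // nk; apply: leq_trans nk.
Qed.

(** * Transposition *)

Section TransposeNaturality.
Variables (X Y : sSet) (f : smap Y X).

Lemma pull_hom_comp (A B C : Defs.over X) (a : over_hom B C) (b : over_hom A B) :
  pull_hom f (over_comp a b) = over_comp (pull_hom f a) (pull_hom f b).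
Proof. by apply: over_homP => n c; apply: pull_cellP. Qed.

Lemma transpose_comp (A A' : Defs.over X) (B : Defs.over Y) (h : over_hom (pull f A) B)
  (a : over_hom A' A) :
  over_comp (transpose h) a = transpose (over_comp h (pull_hom f a)).
Proof.
rewrite -[LHS]transpose_uniq; congr transpose; rewrite pull_hom_comp.
by rewrite -[in RHS](transposeK h); apply: over_homP.
Qed.

End TransposeNaturality.

(* The result is a function in [Type]: a choice of horn fillers is computed from
   the two given choices.  The only logical principles it is given are those of
   choice-free classical set theory, namely excluded middle and definite
   description (functional relations define functions). *)
Theorem mainTheorem5
  (em : forall P : Prop, P \/ ~ P)
  (dd : forall (A : Type) (P : A -> Prop), (exists! a : A, P a) -> {a : A | P a})
  (X Y Z : sSet) (f : smap Y X) (g : smap Z Y)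
  (cf : horn_fillers f) (cg : horn_fillers g) :
  horn_fillers (str (push f (Over g))).
Proof.
move=> n k n_gt0 u v uv.
(* [h] is the transpose of [u]; extending it to the pullback of the whole simplex
   and transposing back extends [u]. *)
pose u' : over_hom (Over (v \os horn_incl k)) (push f (Over g)) := exist _ u uv.
pose h := over_comp (counit f (Over g)) (pull_hom f u').
have sq : g \os over_map h = str (pull f (Over v)) \os over_map (pull_hom f (horn_over k v)).
  by rewrite (proj2_sig h); apply: smapP.
have [w [wh wg]] := pull_horn_filler em dd cf n_gt0 cg sq.
pose w' : over_hom (pull f (Over v)) (Over g) := exist _ w wg.
exists (over_map (transpose w')); split; last exact: (proj2_sig (transpose w')).
have -> : u = over_map u' by [].
rewrite -(transpose_uniq u') -/h.
have <- : over_comp w' (pull_hom f (horn_over k v)) = h.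
  by apply: over_homP => m c; apply: (smap_eq wh).
by rewrite -transpose_comp.
Qed.
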